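(* Let $G$ be a connected (finite, simple) graph with $\beta(G)=|E|-\operatorname{rank}(E)=2$. Then $G$ is uniformly dense if and only if $G$ can be constructed from three paths, of lengths $L_1,L_2,L_3\ge 0$, by identifying their starting vertices into a single vertex and their end vertices into a single vertex, where the lengths satisfy $L_3-L_2\le L_1\le L_2\le L_3$.
   Context: For a graph $G=(V,E)$ and $A\subseteq E$, $c(A)$ denotes the number of connected components of $(V,A)$, $\operatorname{rank}(A)=|V|-c(A)$ (the rank in the cycle matroid, whose bases are spanning trees), and $\rho(A)=|A|/\operatorname{rank}(A)$ for nonempty $A$. $G$ is uniformly dense if $\rho(A)\le\rho(E)$ for all nonempty $A\subseteq E$. A path of length $0$ is a single vertex (so its two ends coincide). *)

(* Defs.v *)
From mathcomp Require Import all_boot all_order all_algebra.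
Set Implicit Arguments. Unset Strict Implicit. Unset Printing Implicit Defensive.
Import Order.TTheory GRing.Theory Num.Theory.

(* A finite simple graph is given by a vertex type V : finType and an
   adjacency relation e : rel V which is symmetric and irreflexive.
   Edges are represented as 2-element vertex sets {x,y}. *)

Section Graphs.
Variables (V : finType) (e : rel V).

Definition edges : {set {set V}} :=
  [set A : {set V} | [exists x, exists y, e x y && (A == [set x; y])]].

Definition subrel (A : {set {set V}}) : rel V :=
  fun x y => (x != y) && ([set x; y] \in A).

Definition ncomp (A : {set {set V}}) : nat :=
  #| [set [set y | connect (subrel A) x y] | x : V] |.

Definition grank (A : {set {set V}}) : nat := #|V| - ncomp A.

Definition rho (A : {set {set V}}) : rat := (#|A|%:R / (grank A)%:R)%R.

Definition connected_graph : Prop := forall x y : V, connect e x y.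

Definition beta : int := (#|edges|%:Z - (grank edges)%:Z)%R.

Definition uniformly_dense : Prop :=
  forall A : {set {set V}}, A \subset edges -> A != set0 -> (rho A <= rho edges)%R.

(* G is (isomorphic to) the graph obtained from three paths P_0, P_1, P_2 of
   lengths L 0, L 1, L 2 (path P_i has vertices (i,0),...,(i, L i)) by
   identifying the three starting vertices (i,0) into one vertex and the three
   end vertices (i, L i) into one vertex (equivalence relation generated;
   so if some L i = 0 the start and end classes coincide).
   f : path vertices -> V is the quotient map; it must identify exactly the
   identified points, be onto V, and induce a bijection between path edges
   {(i,k),(i,k+1)} and the edges of G. *)
Definition pt_identified (L : 'I_3 -> nat) (i : 'I_3) (k : nat) (j : 'I_3) (l : nat) : bool :=
  if ((k == 0) || (k == L i)) && ((l == 0) || (l == L j))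
  then ((k == 0) == (l == 0)) || [exists m : 'I_3, L m == 0]
  else (i == j) && (k == l).

Definition three_path_graph (L : 'I_3 -> nat) : Prop :=
  exists f : 'I_3 -> nat -> V,
    [/\ (forall i k j l, k <= L i -> l <= L j ->
           (f i k == f j l) = pt_identified L i k j l),
        (forall v : V, exists i k, k <= L i /\ f i k = v),
        (forall i k, k < L i -> e (f i k) (f i k.+1)),
        (forall x y, e x y -> exists i k, k < L i /\
             ((f i k = x /\ f i k.+1 = y) \/ (f i k = y /\ f i k.+1 = x)))
      & (forall i k j l, k < L i -> l < L j ->
           [set f i k; f i k.+1] = [set f j l; f j l.+1] -> i = j /\ k = l)].

End Graphs.

Definition lens3 (L1 L2 L3 : nat) : 'I_3 -> nat :=
  fun i => nth 0 [:: L1; L2; L3] i.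

(* Main.v *)
(* Write null(A) = |A| - rank(A) and m = |E|.  As rank(E) = m - 2, density says
   m * null(A) <= 2 |A| for every A.  Hence a dense graph has no bridge, and an
   edge set of nullity 2 must be all of E: a cycle together with an ear
   exhausts the graph, which is thus made of three paths (one of them of
   length 0 if the ear returns to its starting vertex).  Deleting the path of
   length L_i leaves nullity 1, so density forces 2 L_i <= m; conversely, a set
   of nullity 1 contains two of the paths, and these inequalities suffice. *)

Require Import Defs.
From mathcomp Require Import all_boot all_order all_algebra.
From mathcomp Require Import zify.

Set Implicit Arguments. Unset Strict Implicit. Unset Printing Implicit Defensive.

Notation conn A := (connect (Defs.subrel A)).
Notation steps x s := (pairmap (fun a b => [set a; b]) x s).

(** * Unordered pairs and cardinalities of images *)

Lemma set2_inj (T : finType) (x y a b : T) :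
  [set x; y] = [set a; b] -> (x = a /\ y = b) \/ (x = b /\ y = a).
Proof.
move=> E.
have /set2P xab : x \in [set a; b] by rewrite -E set21.
have /set2P yab : y \in [set a; b] by rewrite -E set22.
have /set2P axy : a \in [set x; y] by rewrite E set21.
have /set2P bxy : b \in [set x; y] by rewrite E set22.
by case: xab => xE; case: yab => yE; case: axy => aE; case: bxy => bE; subst; auto.
Qed.

(** On [S], [F] factors as [h] after [G], where [h] picks a preimage under [G]. Used below to
    compare numbers of components. *)
Lemma leq_card_imset_fiber (I T U : finType) (S : {set I}) (F : I -> T) (G : I -> U) :
  {in S &, forall x y, G x = G y -> F x = F y} ->
  #|F @: S| <= #|G @: S|.
Proof.
case: (set_0Vmem S) => [-> _|[x0 x0S] FG]; first by rewrite !imset0 !cards0.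
pose h Y := F (odflt x0 [pick z in S | G z == Y]).
suff -> : F @: S = h @: (G @: S) by apply: leq_imset_card.
rewrite -imset_comp; apply: eq_in_imset => x xS; rewrite /h /=.
case: pickP => [z /andP[zS /eqP Gz]|/(_ x)] /=; last by rewrite xS eqxx.
exact: FG.
Qed.

(** * Components, rank and nullity of edge sets *)

Section Nullity.
Variable V : finType.
Implicit Types (A B : {set {set V}}) (x y z : V).

Definition component A x : {set V} := [set y | conn A x y].

Lemma ncompE A : ncomp A = #|[set component A x | x in [set: V]]|.
Proof. by rewrite /ncomp; apply: eq_card => X; apply/imsetP/imsetP => -[x _ ->]; exists x. Qed.

Lemma subrel_sym A : symmetric (Defs.subrel A).
Proof. by move=> x y; rewrite /Defs.subrel eq_sym setUC. Qed.

Lemma conn_sym A : connect_sym (Defs.subrel A).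
Proof. exact/sym_connect_sym/subrel_sym. Qed.

Lemma conn_sub A B x y : A \subset B -> conn A x y -> conn B x y.
Proof.
move=> /subsetP sAB; apply: connect_sub => a b /andP[ab Aab].
by apply: connect1; rewrite /Defs.subrel ab sAB.
Qed.

Lemma conn_edge A x y : [set x; y] \in A -> conn A x y.
Proof.
move=> Axy; have [-> //|nxy] := eqVneq x y.
by apply: connect1; rewrite /Defs.subrel nxy.
Qed.

Lemma component_eq A x y : (component A x == component A y) = conn A x y.
Proof.
apply/eqP/idP => [/setP/(_ y)|xy]; first by rewrite !inE connect0.
by apply/setP => z; rewrite !inE; apply: (same_connect (@conn_sym A)).
Qed.

Lemma ncomp_le A : ncomp A <= #|V|.
Proof. by rewrite ncompE (leq_trans (leq_imset_card _ _)) // cardsT. Qed.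

Lemma ncomp_conn A B :
  (forall x y, conn B x y -> conn A x y) -> ncomp A <= ncomp B.
Proof.
move=> BA; rewrite !ncompE; apply: leq_card_imset_fiber => x y _ _ /eqP.
by rewrite component_eq => /BA; rewrite -component_eq => /eqP.
Qed.

Lemma grank_conn A B :
  (forall x y, conn A x y -> conn B x y) -> grank A <= grank B.
Proof. by move=> /ncomp_conn AB; rewrite leq_sub2l. Qed.

Lemma grank_sub A B : A \subset B -> grank A <= grank B.
Proof. by move=> AB; apply: grank_conn => x y; apply: conn_sub. Qed.

(** Cut a walk at its first and last use of the new edge: the outer pieces lie in [A]. If it enters
    and leaves the edge on the same side, these pieces already join [x] to [y] in [A]. *)
Lemma conn_setU1 A a b x y :
  conn ([set a; b] |: A) x y ->
  [\/ conn A x y, conn A x a /\ conn A b y | conn A x b /\ conn A a y].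
Proof.
case/connectP => p; elim: p x => [|z p IH] x /=.
  by move=> _ ->; constructor 1.
case/andP => /andP[nxz]; rewrite in_setU1 => xz pz yE.
have {IH} := IH z pz yE.
case/orP: xz => [/eqP/set2_inj|Axz].
  case=> -[-> ->]; case=> [zy|[za yb]|[zb ya]].
  - by constructor 2; rewrite connect0.
  - by constructor 2; rewrite connect0.
  - by constructor 1.
  - by constructor 3; rewrite connect0.
  - by constructor 1.
  - by constructor 3; rewrite connect0.
have xz := conn_edge Axz.
case=> [zy|[za yb]|[zb ya]].
- by constructor 1; apply: connect_trans zy.
- by constructor 2; split => //; apply: connect_trans za.
- by constructor 3; split => //; apply: connect_trans zb.
Qed.

(** Only the component of [b] can disappear: components of points not joined to [b] in [A] stay
    distinct once the edge is added. *)
Lemma ncomp_setU1 A a b : ncomp A <= (ncomp ([set a; b] |: A)).+1.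
Proof.
set A' := _ |: _; rewrite !ncompE.
pose S := [set z | ~~ conn A b z].
have sub : component A @: [set: V] \subset component A b |: component A @: S.
  apply/subsetP => _ /imsetP[z _ ->]; rewrite in_setU1.
  have [zb|nzb] := boolP (conn A b z).
    by rewrite component_eq conn_sym zb.
  by apply/orP; right; apply: imset_f; rewrite inE.
apply: leq_trans (subset_leq_card sub) _.
rewrite cardsU1 -[(#|_|).+1]add1n; apply: leq_add (leq_b1 _) _.
apply: leq_trans (subset_leq_card (imsetS (component A') (subsetT S))).
apply: leq_card_imset_fiber => x y; rewrite !inE => nx ny /eqP.
rewrite component_eq => /conn_setU1[xy|[_ by_]|[xb _]]; apply/eqP.
- by rewrite component_eq.
- by rewrite by_ in ny.
- by rewrite conn_sym xb in nx.
Qed.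

(** Monotonicity of the nullity, written without subtraction. Edges of [B] are added to [A] one at a
    time, and each raises the rank by at most one. *)
Lemma nullity_mono A B :
  A \subset B -> (forall X, X \in B -> exists a b, X = [set a; b]) ->
  #|A| + grank B <= #|B| + grank A.
Proof.
move=> sAB Bpair; have [n] := ubnP (#|B :\: A|).
elim: n => // n IH in A sAB *; rewrite ltnS => le_n.
have [BA0|[X XBA]] := set_0Vmem (B :\: A).
  have -> : A = B by apply/eqP; rewrite eqEsubset sAB -setD_eq0 BA0 /=.
  by [].
have [XB nXA] := setDP XBA.
have [a [b XE]] := Bpair X XB.
have := IH (X |: A).
rewrite subUset sub1set XB sAB => /(_ isT) h.
have hc : #|B :\: (X |: A)| < n.
  by rewrite setUC -setDDl; move: le_n; rewrite (cardsD1 X (B :\: A)) XBA.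
have := h hc; rewrite cardsU1 nXA add1n.
have := ncomp_setU1 A a b; rewrite -XE.
have := ncomp_le A; have := ncomp_le (X |: A); rewrite /grank.
by move: (ncomp (X |: A)) (ncomp A) (ncomp B) #|A| #|B| #|V|; lia.
Qed.

(** The new edge closes a cycle, so components do not change; this is how nullity is gained later
    on. *)
Lemma grank_setU1 A a b : conn A a b -> grank ([set a; b] |: A) = grank A.
Proof.
move=> ab; apply/eqP; rewrite eqn_leq (grank_sub (subsetUr _ _)) andbT.
apply: grank_conn => x y /conn_setU1[//|[xa by_]|[xb ay]].
  exact: connect_trans xa (connect_trans ab by_).
apply: connect_trans xb _; apply: connect_trans ay.
by rewrite conn_sym.
Qed.

Lemma grank_connected A : (forall x y, conn A x y) -> #|V|.-1 <= grank A.
Proof.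
move=> Ac; suff: ncomp A <= 1 by rewrite /grank; lia.
rewrite ncompE; apply/card_le1_eqP => _ _ /imsetP[x _ ->] /imsetP[y _ ->].
by apply/eqP; rewrite component_eq.
Qed.

Lemma connected_grank A x y : #|V|.-1 <= grank A -> conn A x y.
Proof.
move=> h; have : ncomp A <= 1.
  have V0 : 0 < #|V| by apply/card_gt0P; exists x.
  by have := ncomp_le A; move: h; rewrite /grank; lia.
rewrite ncompE => /card_le1_eqP/(_ _ _ (imset_f _ (in_setT x)) (imset_f _ (in_setT y))).
by move/eqP; rewrite component_eq conn_sym.
Qed.

Lemma grank_gt0 A x y : x != y -> [set x; y] \in A -> 0 < grank A.
Proof.
move=> nxy Axy; rewrite subn_gt0 ltn_neqAle ncomp_le andbT ncompE.
apply: contra nxy; rewrite -cardsT => /imset_injP inj.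
by apply/eqP/inj; rewrite ?inE //; apply/eqP; rewrite component_eq conn_edge.
Qed.

Lemma grank_lt A : 0 < #|V| -> grank A < #|V|.
Proof.
case/card_gt0P => x _; rewrite /grank.
have : 0 < ncomp A.
  by rewrite ncompE; apply/card_gt0P; exists (component A x); apply: imset_f.
by have := ncomp_le A; lia.
Qed.

End Nullity.

(** * Uniform density as an inequality between integers *)

Section Density.
Variables (V : finType) (e : rel V).
Hypotheses (e_sym : symmetric e) (e_irr : irreflexive e).

Lemma mem_edges x y : ([set x; y] \in edges e) = e x y.
Proof.
rewrite inE; apply/existsP/idP => [[a /existsP[b /andP[eab /eqP/set2_inj]]]|exy].
  by case=> -[-> ->] //; rewrite e_sym.
by exists x; apply/existsP; exists y; rewrite exy eqxx.
Qed.

Lemma edge_neq x y : e x y -> x != y.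
Proof. by apply: contraTneq => ->; rewrite e_irr. Qed.

Lemma edgesP X : X \in edges e -> exists x y, e x y /\ X = [set x; y].
Proof.
by rewrite inE => /existsP[x /existsP[y /andP[exy /eqP ->]]]; exists x, y.
Qed.

Lemma nullity_edges (A B : {set {set V}}) : A \subset B -> B \subset edges e ->
  #|A| + grank B <= #|B| + grank A.
Proof.
move=> sAB /subsetP sB; apply: nullity_mono => // X /sB/edgesP[x [y [_ ->]]].
by exists x, y.
Qed.

Hypotheses (Gconn : connected_graph e) (Gbeta : beta e = Posz 2).

Lemma card_V_gt0 : 0 < #|V|.
Proof.
move: Gbeta; rewrite /beta => b.
have /card_gt0P[X /edgesP[x _]] : 0 < #|edges e| by lia.
by apply/card_gt0P; exists x.
Qed.

Lemma conn_edges x y : conn (edges e) x y.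
Proof.
apply: connect_sub (Gconn x y) => a b eab.
by apply: conn_edge; rewrite mem_edges.
Qed.

Lemma grank_edges : grank (edges e) = #|V|.-1.
Proof.
have := grank_connected conn_edges; have := grank_lt (edges e) card_V_gt0.
lia.
Qed.

Lemma card_edges : #|edges e| = #|V|.+1.
Proof.
by move: Gbeta card_V_gt0; rewrite /beta grank_edges; lia.
Qed.

Lemma grank_edges_gt0 (A : {set {set V}}) : A \subset edges e -> A != set0 -> 0 < grank A.
Proof.
move=> /subsetP sA /set0Pn[X XA]; have [x [y [exy XE]]] := edgesP (sA _ XA).
by apply: (grank_gt0 (edge_neq exy)); rewrite -XE.
Qed.

(** Clearing denominators gives [|A| * (m - 2) <= m * rank(A)] with [m = |E|], since
    [rank(E) = m - 2]; moving terms avoids truncated subtraction. Nonempty sets have positive rank,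
    and the empty set satisfies the inequality trivially. *)
Lemma uniformly_denseP :
  uniformly_dense e <->
  forall A : {set {set V}}, A \subset edges e ->
    #|edges e| * #|A| <= 2 * #|A| + #|edges e| * grank A.
Proof.
suff H (A : {set {set V}}) : A \subset edges e -> A != set0 ->
    (rho A <= rho (edges e))%R =
    (#|edges e| * #|A| <= 2 * #|A| + #|edges e| * grank A).
  split=> [D A sA|D A sA A0]; last by rewrite H // D.
  have [->|A0] := eqVneq A set0; first by rewrite cards0 !muln0.
  by rewrite -H // D.
move=> sA A0.
have r0 := grank_edges_gt0 sA A0.
have E0 : edges e != set0 by rewrite -card_gt0 card_edges.
have rE := grank_edges_gt0 (subxx _) E0.
rewrite /rho Num.Theory.ler_pdivrMr ?Num.Theory.ltr0n //.
rewrite GRing.mulrAC Num.Theory.ler_pdivlMr ?Num.Theory.ltr0n //.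
rewrite -!GRing.natrM Num.Theory.ler_nat.
have -> : #|edges e| * #|A| = 2 * #|A| + #|A| * grank (edges e).
  have Em : #|edges e| = grank (edges e) + 2.
    by move: card_edges grank_edges rE; lia.
  by rewrite {1}Em mulnDl addnC [grank _ * _]mulnC.
by rewrite leq_add2l.
Qed.

End Density.

Lemma grank_le_card (V : finType) (e : rel V) (A : {set {set V}}) :
  A \subset edges e -> grank A <= #|A|.
Proof.
move=> sA; have := nullity_edges (sub0set A) sA.
suff -> : grank (set0 : {set {set V}}) = 0 by rewrite cards0 add0n addn0.
apply/eqP; rewrite /grank subn_eq0 ncompE -cardsT card_imset // => x y /eqP.
rewrite component_eq => /connectP[[|z p] /=]; first by move=> _ ->.
by rewrite /Defs.subrel inE andbF.
Qed.

Lemma ord3_third (i j : 'I_3) : exists h : 'I_3, (h != i) && (h != j).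
Proof.
have : 0 < #|~: [set i; j]|.
  by have := cardsC [set i; j]; rewrite card_ord cards2; case: (i != j) => /=; lia.
by case/card_gt0P => h; rewrite !inE negb_or => hh; exists h.
Qed.

(** * Density of a graph made of three paths *)

Section ThreePaths.
Variables (V : finType) (e : rel V).
Implicit Types (A B : {set {set V}}).
Hypotheses (e_sym : symmetric e) (e_irr : irreflexive e).
Hypotheses (Gconn : connected_graph e) (Gbeta : beta e = Posz 2).
Variables (L : 'I_3 -> nat) (f : 'I_3 -> nat -> V).
Hypothesis f_id : forall i k j l, k <= L i -> l <= L j ->
  (f i k == f j l) = pt_identified L i k j l.
Hypothesis f_onto : forall v : V, exists i k, k <= L i /\ f i k = v.
Hypothesis f_edge : forall i k, k < L i -> e (f i k) (f i k.+1).
Hypothesis f_edges : forall x y, e x y -> exists i k, k < L i /\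
  ((f i k = x /\ f i k.+1 = y) \/ (f i k = y /\ f i k.+1 = x)).
Hypothesis f_inj : forall i k j l, k < L i -> l < L j ->
  [set f i k; f i k.+1] = [set f j l; f j l.+1] -> i = j /\ k = l.

Notation g i k := [set f i k; f i k.+1].
Definition path_edges (i : 'I_3) : {set {set V}} := [set g i (val k) | k : 'I_(L i)].

Lemma path_edgesP i X :
  reflect (exists2 k, k < L i & X = g i k) (X \in path_edges i).
Proof.
apply: (iffP imsetP) => [[k _ ->]|[k kL ->]]; first by exists k.
by exists (Ordinal kL).
Qed.

Lemma mem_path_edges i k : k < L i -> g i k \in path_edges i.
Proof. by move=> kL; apply/path_edgesP; exists k. Qed.

Lemma card_path_edges i : #|path_edges i| = L i.
Proof.
rewrite card_imset ?card_ord // => k l E; apply: val_inj.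
by have [] := f_inj (ltn_ord k) (ltn_ord l) E.
Qed.

Lemma path_edges_sub i : path_edges i \subset edges e.
Proof.
apply/subsetP => _ /path_edgesP[k kL ->].
by rewrite mem_edges; [apply: f_edge|].
Qed.

Lemma edges_path_edges X : X \in edges e -> exists i, X \in path_edges i.
Proof.
case/edgesP => x [y [/f_edges[i [k [kL h]]] ->]]; exists i; apply/path_edgesP.
by exists k => //; case: h => -[-> ->] //; rewrite setUC.
Qed.

Lemma path_edges_inj i j X : X \in path_edges i -> X \in path_edges j -> i = j.
Proof. by case/path_edgesP => k kL -> /path_edgesP[l lL] /(f_inj kL lL)[]. Qed.

Lemma card_edges_paths : #|edges e| = \sum_i L i.
Proof.
(* Paths of length 0 all have the empty edge set; discarding them makes [path_edges] injective on
   the remaining indices, as [big_imset] requires. *)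
have -> : edges e = cover [set path_edges i | i : 'I_3 & L i != 0].
  apply/setP => X; apply/idP/bigcupP => [/edges_path_edges[i Xi]|].
    exists (path_edges i) => //; apply: imset_f; rewrite inE.
    by apply: contraTneq Xi => Li0; apply/path_edgesP => -[k]; rewrite Li0.
  by case=> _ /imsetP[i _ ->]; apply/subsetP/path_edges_sub.
have /eqP <- : trivIset [set path_edges i | i : 'I_3 & L i != 0].
  apply/trivIsetP => _ _ /imsetP[i _ ->] /imsetP[j _ ->] nij.
  rewrite -setI_eq0; apply: contraNT nij => /set0Pn[X /setIP[Xi Xj]].
  by rewrite (path_edges_inj Xi Xj).
rewrite big_imset /= => [|i j]; last first.
  rewrite inE -lt0n => Li _ Eij; apply: (path_edges_inj (mem_path_edges Li)).
  by rewrite -Eij; apply: mem_path_edges.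
rewrite (eq_bigr L) => [|i _]; last exact: card_path_edges.
rewrite [RHS](bigID (fun i => L i != 0)) /= [X in _ + X]big1 ?addn0.
  by apply: eq_bigl => i; rewrite inE.
by move=> i /negPn/eqP.
Qed.

Lemma path_start i j : f i 0 = f j 0.
Proof. by apply/eqP; rewrite f_id // /pt_identified eqxx. Qed.

Lemma path_end i j : f i (L i) = f j (L j).
Proof.
apply/eqP; rewrite f_id // /pt_identified !eqxx !orbT /=.
have [Li0|Li] := eqVneq (L i) 0; have [Lj0|Lj] := eqVneq (L j) 0 => //=.
  by apply/existsP; exists i; rewrite Li0.
by apply/existsP; exists j; rewrite Lj0.
Qed.

(** The vertices of a path other than its last one are distinct; the last is left out because it may
    coincide with the first. *)
Lemma path_length_le_card i : L i <= #|V|.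
Proof.
rewrite -[L i]card_ord; apply: (@leq_card _ _ (fun k : 'I_(L i) => f i k)).
move=> k l /eqP; rewrite f_id ?(ltnW (ltn_ord _)) // /pt_identified.
rewrite !(ltn_eqF (ltn_ord _)) !orbF eqxx /= => h; apply: val_inj => /=.
case: ifP h => [/andP[/eqP-> /eqP->] //|_ /eqP //].
Qed.

Lemma conn_along B i a b : a <= b ->
  (forall k, a <= k < b -> g i k \in B) -> conn B (f i a) (f i b).
Proof.
elim: b => [|b IH]; first by rewrite leqn0 => /eqP->.
rewrite leq_eqVlt => /predU1P[-> //|]; rewrite ltnS => ab h.
apply: connect_trans (IH ab _) _ => [k /andP[ak kb]|].
  by apply: h; rewrite ak ltnW.
by apply/conn_edge/h; rewrite ab /=.
Qed.

(** If each path lacks at most one edge, a vertex before the gap goes back to the common start and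
    one after it goes on to the common end; the complete path [h] joins start and end. An index [m]
    beyond the length means no gap. *)
Lemma conn_almost_all_edges B h :
  path_edges h \subset B ->
  (forall i, exists m, forall k, k < L i -> k != m -> g i k \in B) ->
  forall x y, conn B x y.
Proof.
move=> /subsetP hB miss x y.
suff H v : conn B (f h 0) v.
  by apply: connect_trans (H y); rewrite conn_sym.
have [i [a [aL <-]]] := f_onto v; have [m mB] := miss i.
have [am|ma] := leqP a m.
  rewrite (path_start h i); apply: conn_along => // k /andP[_ ka].
  by apply: mB; [apply: leq_trans ka aL | rewrite ltn_eqF // (leq_trans ka)].
apply: (@connect_trans _ _ (f h (L h))).
  by apply: conn_along => // k /andP[_ kL]; apply/hB/mem_path_edges.
rewrite (path_end h i) conn_sym; apply: conn_along => // k /andP[ak kL].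
by apply: mB => //; rewrite gtn_eqF // (leq_trans ma).
Qed.

(** The two paths other than [h] form a cycle: the ends of the first edge of path [i] remain joined
    through the rest of path [i] and the third path [j], so that edge adds nothing to the rank. *)
Lemma grank_two_paths h i : i != h -> 0 < L i ->
  grank (edges e :\: path_edges h) < #|edges e :\: path_edges h|.
Proof.
move=> ih Li; set A := _ :\: _.
have A0 : g i 0 \in A.
  rewrite inE (subsetP (path_edges_sub i)) ?mem_path_edges // andbT.
  by apply: contra ih => /(path_edges_inj (mem_path_edges Li)) ->.
have cA : conn (A :\ g i 0) (f i 0) (f i 1).
  have [j /andP[ji jh]] := ord3_third i h.
  have inA p k : p != h -> k < L p -> (p != i) || (0 < k) -> g p k \in A :\ g i 0.
    move=> ph kL pik; rewrite in_setD1 in_setD (subsetP (path_edges_sub p)) ?mem_path_edges //.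
    rewrite andbT; apply/andP; split.
      by apply: contraTneq pik => /f_inj[] // -> ->; rewrite eqxx.
    by apply: contra ph => /(path_edges_inj (mem_path_edges kL)) ->.
  apply: (@connect_trans _ _ (f i (L i))).
    suff : conn (A :\ g i 0) (f j 0) (f j (L j)).
      by rewrite (path_start j i) (path_end j i).
    apply: conn_along => // k /andP[_ kL].
    by apply: inA; rewrite ?ji.
  rewrite conn_sym; apply: conn_along => // k /andP[k0 kL].
  by apply: inA; rewrite ?k0 ?orbT.
rewrite (cardsD1 (g i 0) A) A0 add1n ltnS -(setD1K A0) grank_setU1 //.
rewrite setD1K //; apply: (@grank_le_card _ e).
by apply: subset_trans (subsetDl _ _) (subsetDl _ _).
Qed.

Lemma uniformly_dense_three_paths :
  uniformly_dense e <-> forall h, 2 * L h <= #|edges e|.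
Proof.
have cE := card_edges e_sym Gconn Gbeta.
have rE := grank_edges e_sym Gconn Gbeta.
have V0 := card_V_gt0 Gbeta.
rewrite uniformly_denseP //; split=> [D h|H A sA].
  (* Otherwise path [h] holds all [|V| + 1] edges, although its length is at most [|V|]. *)
  have [i ih Li] : exists2 i, i != h & 0 < L i.
    apply/exists_inP; rewrite -[X in is_true X]negbK negb_exists_in.
    apply/negP => /forall_inP Z; have := path_length_le_card h.
    rewrite -ltnS -cE card_edges_paths (bigD1 h) //= big1 ?addn0 ?ltnn // => i ih.
    by have := Z i ih; rewrite -eqn0Ngt => /eqP.
  (* This set has [m - L h] edges and nullity at least 1, so density yields [m <= 2 * (m - L h)]. *)
  have := D (edges e :\: path_edges h) (subsetDl _ _).
  have := grank_two_paths ih Li.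
  have := cardsID (path_edges h) (edges e).
  rewrite (setIidPr (path_edges_sub h)) card_path_edges.
  move: (grank _) #|_ :\: _| #|edges e| (L h) => r a m l; nia.
(* Three cases, by how many paths fail to lie in [A]: none, at least two, or exactly one. *)
have [sEA|] := boolP (edges e \subset A).
  have -> : A = edges e by apply/eqP; rewrite eqEsubset sA.
  by rewrite rE; move: cE; move: #|edges e| #|V| V0; nia.
case/subsetPn => X XE XA; have [i Xi] := edges_path_edges XE.
have [k kL Xk] := path_edgesP _ _ Xi.
have [/existsP[j /andP[ji /subsetPn[Y Yj YA]]]|] :=
    boolP [exists j, (j != i) && ~~ (path_edges j \subset A)].
  have [l lL Yl] := path_edgesP _ _ Yj.
  have YE := subsetP (path_edges_sub j) _ Yj.
  have XY : Y != X by apply: contra ji => /eqP YX; apply/eqP/(path_edges_inj Yj); rewrite YX.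
  (* With one edge removed from each of two paths, [B] is connected with [|V| - 1] edges: it has
     nullity 0, hence so has its subset [A]. *)
  pose B := edges e :\ X :\ Y.
  have inB p q : q < L p -> g p q != X -> g p q != Y -> g p q \in B.
    by move=> qL h1 h2; rewrite !in_setD1 h1 h2 (subsetP (path_edges_sub p)) ?mem_path_edges.
  have [h /andP[hi hj]] := ord3_third i j.
  have cB : forall x y, conn B x y.
    apply: (@conn_almost_all_edges _ h).
      apply/subsetP => _ /path_edgesP[q qL ->]; have qh := mem_path_edges qL.
      apply: inB => //.
        by apply: contra hi => /eqP qX; apply/eqP/(path_edges_inj qh); rewrite qX.
      by apply: contra hj => /eqP qY; apply/eqP/(path_edges_inj qh); rewrite qY.
    move=> p; have [->|pi] := eqVneq p i.
      exists k => q qL qk; apply: inB => //.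
        by apply: contra qk; rewrite Xk => /eqP/f_inj[] // _ ->.
      by apply: contra ji; rewrite Yl => /eqP/f_inj[] // ->.
    exists l => q qL ql; apply: inB => //.
      by apply: contra pi; rewrite Xk => /eqP/f_inj[] // ->.
    by apply: contra ql; rewrite Yl => /eqP/f_inj[] // _ ->.
  have sAB : A \subset B.
    apply/subsetP => Z ZA; rewrite !in_setD1 (subsetP sA) // andbT.
    by apply/andP; split; apply: contraTneq ZA => ->.
  have sB : B \subset edges e by apply: subset_trans (subsetDl _ _) (subsetDl _ _).
  have := nullity_edges sAB sB; have := grank_connected cB.
  have := cardsD1 X (edges e); have := cardsD1 Y (edges e :\ X).
  rewrite in_setD1 XY YE XE /= -/B cE.
  move: (grank A) (grank B) #|A| #|B| #|_ :\ _| #|V| V0; nia.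
move=> /existsPn sub.
have {}sub j : j != i -> path_edges j \subset A.
  by move=> ji; have := sub j; rewrite ji negbK.
(* Here [B] is connected with [|V|] edges, so [A] has nullity at most 1. As [A] contains the other
   two paths, [|A| >= m - L i >= m / 2], which is what density asks. *)
pose B := edges e :\ X.
have sAB : A \subset B.
  apply/subsetP => Z ZA; rewrite !in_setD1 (subsetP sA) // andbT.
  by apply: contraTneq ZA => ->.
have cB : forall x y, conn B x y.
  have [h /andP[hi _]] := ord3_third i i.
  apply: (@conn_almost_all_edges _ h); first exact: subset_trans (sub h hi) sAB.
  move=> p; have [->|pi] := eqVneq p i.
    exists k => q qL qk; rewrite in_setD1 (subsetP (path_edges_sub i)) ?mem_path_edges // andbT.
    by apply: contra qk; rewrite Xk => /eqP/f_inj[] // _ ->.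
  (* Path [p] lies entirely in [A], so any index may stand for its gap. *)
  exists 0 => q qL _; apply: (subsetP (subset_trans (sub p pi) sAB)).
  exact: mem_path_edges.
have cA : #|edges e| <= #|A| + L i.
  rewrite -(card_path_edges i) -cardsUI; apply: leq_trans (leq_addr _ _).
  apply/subset_leq_card/subsetP => Z ZE; have [j Zj] := edges_path_edges ZE.
  rewrite inE; have [<-|ji] := eqVneq j i; first by rewrite Zj orbT.
  by rewrite (subsetP (sub j ji)).
have := nullity_edges sAB (subsetDl _ _); have := grank_connected cB.
have := cardsD1 X (edges e); rewrite XE -/B.
have := H i; rewrite cE in cA *.
move: (grank A) (grank B) #|A| #|B| #|V| (L i) V0 cA; nia.
Qed.

End ThreePaths.

(** * Permuting the paths so that their lengths increase *)

Lemma three_path_graph_reindex (V : finType) (e : rel V) (L L' : 'I_3 -> nat)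
    (s : 'I_3 -> 'I_3) :
  injective s -> (forall i, L' i = L (s i)) ->
  three_path_graph e L -> three_path_graph e L'.
Proof.
move=> s_inj LL' [f [f_id f_onto f_edge f_edges f_inj]].
pose r := invF s_inj.
have rs i : s (r i) = i by apply: f_invF.
exists (fun i => f (s i)); split.
- move=> i k j l; rewrite !LL' => kL lL; rewrite f_id // /pt_identified !LL'.
  rewrite (inj_eq s_inj); congr (if _ then _ || _ else _).
  apply/existsP/existsP => -[m Lm]; last by exists (s m); rewrite -LL'.
  by exists (r m); rewrite LL' rs.
- by move=> v; have [i [k]] := f_onto v; exists (r i), k; rewrite LL' rs.
- by move=> i k; rewrite LL'; apply: f_edge.
- move=> x y /f_edges[i [k]]; exists (r i), k.
  by rewrite LL' rs.
- move=> i k j l; rewrite !LL' => kL lL /(f_inj _ _ _ _ kL lL)[/s_inj -> ->].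
  by [].
Qed.

Lemma sort3 (L : 'I_3 -> nat) : exists L1 L2 L3 (s : 'I_3 -> 'I_3),
  [/\ L1 <= L2, L2 <= L3, injective s & forall i, lens3 L1 L2 L3 i = L (s i)].
Proof.
pose r := sort (relpre L leq) (enum 'I_3).
have r3 : size r = 3 by rewrite size_sort size_enum_ord.
have r_uniq : uniq r by rewrite sort_uniq enum_uniq.
have : sorted (relpre L leq) r by apply: sort_sorted => i j; apply: leq_total.
move: r r3 r_uniq => [|a [|b [|c [|? ?]]]] // _ abc /and3P[ab bc _].
exists (L a), (L b), (L c), (fun i => nth a [:: a; b; c] i); split=> //.
  by move=> i j /eqP; rewrite nth_uniq //= => /eqP/val_inj.
by case=> [[|[|[|]]]].
Qed.


(** * Recognising a three-path graph from three walks *)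

Lemma mem_steps (V : finType) (x : V) s X :
  reflect (exists2 k, k < size s & X = [set nth x (x :: s) k; nth x (x :: s) k.+1])
          (X \in steps x s).
Proof.
apply: (iffP (nthP set0)); rewrite size_pairmap => -[k kL].
  by rewrite (nth_pairmap x) // => <-; exists k.
by move=> ->; exists k; rewrite // (nth_pairmap x).
Qed.

Section Walks.
Variables (V : finType) (e : rel V).
Hypotheses (e_sym : symmetric e) (e_irr : irreflexive e).
Hypotheses (Gconn : connected_graph e) (Gbeta : beta e = Posz 2).

Lemma has_neighbour v : exists y, e v y.
Proof.
have /card_gt0P[X /edgesP[a [b [eab _]]]] : 0 < #|edges e|.
  by rewrite (card_edges e_sym).
have /connectP[[|z p] /=] := Gconn v a; first by move=> _ <-; exists b.
by case/andP => evz _ _; exists z.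
Qed.

(** The list [T i] omits the starting vertex [u], so that [uniq] also allows a closed walk.
    Distinctness of the edges is not assumed: it follows from covering and counting. *)
Lemma three_path_graph_walks (u w : V) (T : 'I_3 -> seq V) :
  (forall i, [/\ path e u (T i), last u (T i) = w, uniq (T i) & u \in T i -> u = w]) ->
  (forall i j x, i != j -> x \in T i -> x \in T j -> x = w) ->
  (u = w -> exists m, T m = [::]) ->
  (forall X, X \in edges e -> exists i, X \in steps u (T i)) ->
  \sum_i size (T i) <= #|edges e| ->
  three_path_graph e (fun i => size (T i)).
Proof.
move=> walkT disjT nilT coverT countT.
pose f i k := nth u (u :: T i) k.
(* The map from steps to edges covers all of [edges e], and there are at most [|E|] steps; hence it
   is injective. *)
have f_inj i k j l : k < size (T i) -> l < size (T j) ->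
    [set f i k; f i k.+1] = [set f j l; f j l.+1] -> i = j /\ k = l.
  pose S := {i : 'I_3 & 'I_(size (T i))}.
  pose g (z : S) := [set f (tag z) (tagged z); f (tag z) (tagged z).+1].
  have g_inj : {in [set: S] &, injective g}.
    apply/imset_injP; rewrite eqn_leq leq_imset_card /= cardsT card_tagged.
    rewrite sumnE big_map big_enum /= (eq_bigr (fun i => size (T i))); last first.
      by move=> ? _; rewrite card_ord.
    apply: leq_trans countT _; apply/subset_leq_card/subsetP => X.
    case/coverT => h /mem_steps[m mL ->]; apply/imsetP.
    by exists (Tagged (fun i => 'I_(size (T i))) (Ordinal mL)).
  move=> kL lL E.
  have := g_inj (Tagged _ (Ordinal kL)) (Tagged _ (Ordinal lL)).
  rewrite !in_setT => /(_ isT isT E) E2.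
  split; first exact: (congr1 tag E2).
  exact: (congr1 (fun z : S => val (tagged z)) E2).
have f_end i : f i (size (T i)) = w.
  by have [_ <- _ _] := walkT i; rewrite /f (last_nth u).
have f_pos i k : 0 < k <= size (T i) -> f i k \in T i.
  by case: k => // k; apply: mem_nth.
have f_mid i k : k <= size (T i) -> k != 0 -> k != size (T i) ->
    f i k != u /\ f i k != w.
  move=> kL k0 kT; have [_ _ uT uw] := walkT i.
  have fw : f i k != w.
    rewrite -(f_end i); case: k k0 kL kT => // k _ kL kT; rewrite /f.
    case E: (size (T i)) kL kT => [//|n] kL kT /=.
    by rewrite nth_uniq ?E.
  split=> //; apply: contra fw => /eqP fu.
  by rewrite fu uw // -fu f_pos // lt0n k0.
exists f; split=> //.
- move=> i k j l kL lL; rewrite /pt_identified.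
  have endE h m : m <= size (T h) -> (m == 0) || (m == size (T h)) ->
      f h m = if m == 0 then u else w.
    by move=> _ /orP[] /eqP ->; [rewrite eqxx | case: eqP => [{1}->|] //].
  case: ifP => [/andP[ke le]|].
    rewrite !endE //.
    (* An empty walk forces [u = w], and [nilT] gives the converse; this matches the clause of
       [pt_identified] on paths of length 0. *)
    have -> : [exists m, size (T m) == 0] = (u == w).
      apply/existsP/eqP => [[m]|/nilT[m Tm]]; last by exists m; rewrite Tm.
      by have [_ <- _ _] := walkT m; rewrite size_eq0 => /eqP ->.
    by case: (k == 0); case: (l == 0); rewrite ?eqxx // eq_sym.
  have [ke|kn] /= := boolP ((k == 0) || (k == size (T i))).
    move=> ln; have /norP[l0 lT] := negbT ln.
    have [fu fw] := f_mid j l lL l0 lT.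
    rewrite endE //; transitivity false.
      by apply/negbTE; case: (k == 0); rewrite eq_sym.
    apply/esym/negbTE/negP => /andP[/eqP ij /eqP kl]; subst.
    by rewrite ke in ln.
  move=> _; have /norP[k0 kT] := kn; have [fu fw] := f_mid i k kL k0 kT.
  have [le|] := boolP ((l == 0) || (l == size (T j))).
    rewrite [f j l]endE //; transitivity false.
      by apply/negbTE; case: (l == 0).
    apply/esym/negbTE/negP => /andP[/eqP ij /eqP kl]; subst.
    by rewrite le in kn.
  move=> /norP[l0 lT].
  have fi : f i k \in T i by rewrite f_pos // lt0n k0.
  have fj : f j l \in T j by rewrite f_pos // lt0n l0.
  have [ij|nij] /= := eqVneq i j.
    subst j; have [_ _ uT _] := walkT i.
    case: k l k0 l0 kL lL {kT lT fu fw fi fj kn} => [|k] [|l] // _ _ kL lL.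
    by rewrite /f /= nth_uniq.
  apply/negbTE; apply: contra fw => /eqP fij; apply/eqP.
  by apply: (disjT i j) => //; rewrite fij.
(* No vertex is isolated, so covering the edges covers the vertices. *)
- move=> v; have [y evy] := has_neighbour v.
  have [|i /mem_steps[k kL]] := coverT [set v; y]; first by rewrite (mem_edges e_sym).
  by case/set2_inj => -[-> _]; exists i; [exists k|exists k.+1]; split=> //; apply: ltnW.
- by move=> i k kL; have [/(pathP u)/(_ k kL)] := walkT i.
- move=> x y exy.
  have [|i /mem_steps[k kL E]] := coverT [set x; y]; first by rewrite (mem_edges e_sym).
  exists i, k; split=> //.
  by case/set2_inj: E => -[-> ->]; [left|right].
Qed.

End Walks.

(** * Edges traversed by a walk *)

Section Steps.
Variable V : finType.
Implicit Types (B : {set {set V}}) (x y z : V) (s t : seq V).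

Lemma path_subrel B x s : path (Defs.subrel B) x s -> {subset steps x s <= B}.
Proof.
elim: s x => //= y s IH x /andP[/andP[_ xy] /IH ys] X.
by rewrite in_cons => /predU1P[->|/ys].
Qed.

Lemma conn_steps B x s z : {subset steps x s <= B} -> z \in x :: s -> conn B x z.
Proof.
elim: s x => [|y s IH] x /= sB; first by rewrite mem_seq1 => /eqP->.
rewrite in_cons => /predU1P[->|zs]; first exact: connect0.
apply: (@connect_trans _ _ y); first by apply/conn_edge/sB/mem_head.
by apply: IH zs => X Xs; apply: sB; rewrite in_cons Xs orbT.
Qed.

Lemma conn_uniq_path B x y : conn B x y ->
  exists p, [/\ path (Defs.subrel B) x p, uniq (x :: p) & last x p = y].
Proof. by case/connectP => p0 /shortenP[p pP p_uniq _] ->; exists p. Qed.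

Lemma steps_rev w s : steps (last w s) (rev (belast w s)) =i steps w s.
Proof.
elim: s w => //= y s IH w X.
rewrite rev_cons -cats1 pairmap_cat mem_cat IH /=.
have -> : last (last y s) (rev (belast y s)) = y.
  by case: s {IH} => //= z s; rewrite rev_cons last_rcons.
by rewrite !in_cons in_nil orbF orbC setUC.
Qed.

Lemma mem_of_steps x s X y : X \in steps x s -> y \in X -> y \in x :: s.
Proof.
elim: s x => //= z s IH x; rewrite in_cons => /predU1P[->|Xs yX].
  by case/set2P=> ->; rewrite !inE eqxx ?orbT.
by rewrite in_cons (IH z Xs yX) orbT.
Qed.

End Steps.

(** * Cycle and ear in a uniformly dense graph *)

Section Ears.
Variables (V : finType) (e : rel V).
Hypotheses (e_sym : symmetric e) (e_irr : irreflexive e).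
Hypotheses (Gconn : connected_graph e) (Gbeta : beta e = Posz 2).
Hypothesis dense : uniformly_dense e.
Implicit Types (B C : {set {set V}}) (x y z : V) (s t : seq V).

Lemma path_steps x s : path e x s -> {subset steps x s <= edges e}.
Proof.
elim: s x => //= y s IH x /andP[exy /IH ys] X.
by rewrite in_cons => /predU1P[->|/ys //]; rewrite (mem_edges e_sym).
Qed.

Lemma path_subrel_edges B x s : B \subset edges e ->
  path (Defs.subrel B) x s -> path e x s.
Proof.
move=> /subsetP sB; apply: sub_path => a b /andP[_ /sB].
by rewrite (mem_edges e_sym).
Qed.

(** Density with nullity at least 2 reads [2 * m <= 2 * |B|], so [B] has as many edges as the
    graph. *)
Lemma nullity2_eq_edges B :
  B \subset edges e -> grank B + 2 <= #|B| -> B = edges e.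
Proof.
move=> sB h; apply/eqP; rewrite eqEcard sB /=.
have /(_ B sB) := (uniformly_denseP e_sym e_irr Gconn Gbeta).1 dense.
have := card_edges e_sym Gconn Gbeta.
move: (grank B) #|B| #|edges e| #|V| h; nia.
Qed.

(** If deleting [X] lowered the rank, the remaining [|V|] edges would have nullity at least 2 and
    would be all of [edges e], although [X] is missing. *)
Lemma dense_bridgeless X x y : X \in edges e -> conn (edges e :\ X) x y.
Proof.
move=> XE; apply: connected_grank.
have cE := card_edges e_sym Gconn Gbeta.
have c1 := cardsD1 X (edges e); rewrite XE in c1.
have [//|h] := leqP #|V|.-1 (grank (edges e :\ X)).
have /(nullity2_eq_edges (subsetDl _ _)) E : grank (edges e :\ X) + 2 <= #|edges e :\ X|.
  by move: (grank _) #|_ :\ _| #|edges e| #|V| c1 cE h; lia.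
by move: XE; rewrite -E setD11.
Qed.

Definition walk_set x s : {set {set V}} := [set X in steps x s].

(** Take any edge and a simple path joining its ends without it, which exists as there is no bridge.
    The edge closes the path and makes the nullity positive. *)
Lemma exists_cycle : exists x t,
  [/\ path e x t, last x t = x, uniq t, t != [::] & grank (walk_set x t) < #|walk_set x t|].
Proof.
have /card_gt0P[x _] := card_V_gt0 Gbeta.
have [y exy] := has_neighbour e_sym Gconn Gbeta x.
have XE : [set x; y] \in edges e by rewrite (mem_edges e_sym).
have [p [pP p_uniq yE]] := conn_uniq_path (dense_bridgeless x y XE).
have sp := path_subrel pP.
have epP := path_subrel_edges (subsetDl _ _) pP.
exists x, (rcons p x); split.
- by rewrite rcons_path epP yE e_sym.
- by rewrite last_rcons.
- by rewrite rcons_uniq.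
- by rewrite -size_eq0 size_rcons.
have -> : walk_set x (rcons p x) = [set x; y] |: walk_set x p.
  apply/setP => Z; rewrite !inE -cats1 pairmap_cat mem_cat /= mem_seq1.
  by rewrite orbC yE [[set x; _]]setUC.
rewrite grank_setU1; last first.
  by apply: (@conn_steps _ _ _ p); [move=> Z; rewrite inE | rewrite -yE mem_last].
rewrite cardsU1 inE.
have -> : [set x; y] \in steps x p = false.
  by apply/negP => /sp; rewrite setD11.
rewrite ltnS; apply: (@grank_le_card _ e); apply/subsetP => Z; rewrite inE.
exact: path_steps.
Qed.

Lemma rotate_cycle x t u : path e x t -> last x t = x -> u \in t ->
  exists t', [/\ path e u t', last u t' = u, perm_eq t' t & walk_set u t' = walk_set x t].
Proof.
move=> tP tl ut; case/path.splitP: ut tP tl => s1 s2.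
rewrite cat_path last_rcons last_cat last_rcons => /andP[s1P s2P] s2l.
exists (s2 ++ rcons s1 u); split.
- by rewrite cat_path s2P s2l.
- by rewrite last_cat last_rcons.
- by rewrite perm_catC.
- by apply/setP => X; rewrite !inE !pairmap_cat !mem_cat s2l last_rcons orbC.
Qed.

(** Otherwise the vertices of the cycle are closed under adjacency, hence are all vertices, and
    every edge is on the cycle: then [|V| + 1 = |E| <= size t <= |V|]. *)
Lemma edge_leaving_cycle x t : path e x t -> last x t = x -> uniq t -> t != [::] ->
  exists u v, [/\ u \in t, e u v & [set u; v] \notin walk_set x t].
Proof.
move=> tP tl t_uniq t0.
have xt : x \in t by case: t t0 tl {tP t_uniq} => //= z t _ <-; apply: mem_last.
have [/existsP[u /existsP[v /and3P[]]]|/existsPn no] :=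
    boolP [exists u, exists v, [&& u \in t, e u v & [set u; v] \notin walk_set x t]].
  by exists u, v.
have inC u v : u \in t -> e u v -> [set u; v] \in walk_set x t.
  move=> ut euv; have /existsPn/(_ v) := no u.
  by rewrite ut euv /= negbK.
have t_closed : closed e (mem t).
  apply: intro_closed => [|u v euv ut]; first exact: sym_connect_sym.
  have := inC u v ut euv; rewrite inE => /mem_of_steps/(_ (set22 u v)).
  by rewrite in_cons => /predU1P[->|].
have sub : edges e \subset walk_set x t.
  apply/subsetP => _ /edgesP[a [b [eab ->]]]; apply: inC => //.
  by rewrite -(closed_connect t_closed (Gconn x a)).
have := subset_leq_card sub; rewrite (card_edges e_sym Gconn Gbeta).
have : #|walk_set x t| <= size t.
  by rewrite cardsE -(size_pairmap (fun a b => [set a; b]) x t) card_size.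
have : size t <= #|V| by rewrite -(card_uniqP t_uniq) max_card.
by move=> h1 h2 h3; have := leq_trans h3 (leq_trans h2 h1); rewrite ltnn.
Qed.

(* A walk leaving the cycle by an unused edge comes back, since there are no
   bridges; cut at its first return, it raises the nullity to 2, which by
   density forces the cycle and the ear to exhaust the graph. *)
Lemma exists_ear u t : path e u t -> last u t = u -> uniq t -> u \in t ->
  grank (walk_set u t) < #|walk_set u t| ->
  forall v, e u v -> [set u; v] \notin walk_set u t ->
  exists s w, [/\ path e u (rcons s w), w \in t, uniq (t ++ s) &
    forall X, X \in edges e -> (X \in steps u t) || (X \in steps u (rcons s w))].
Proof.
move=> tP tl t_uniq ut tnull v euv uvC.
have XE : [set u; v] \in edges e by rewrite (mem_edges e_sym).
have [q [qP q_uniq uE]] := conn_uniq_path (dense_bridgeless v u XE).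
have sq := path_subrel qP.
have eqP := path_subrel_edges (subsetDl _ _) qP.
have [s [w [s2 [vqE wt st]]]] : exists s w s2,
    [/\ v :: q = rcons s w ++ s2, w \in t & ~~ has (mem t) s].
  have : has (mem t) (v :: q) by apply/hasP; exists u => //; rewrite -uE mem_last.
  by case/split_find => w s s2 wt st; exists s, w, s2.
have [r [sE qE]] : exists r, rcons s w = v :: r /\ q = r ++ s2.
  by case: (s) vqE => [|z s'] /= [-> ->]; [exists [::] | exists (rcons s' w)].
have lr : last v r = w by rewrite -[last v r]/(last v (v :: r)) -sE last_rcons.
have sr : {subset steps v r <= edges e :\ [set u; v]}.
  by move=> X Xr; apply: sq; rewrite qE pairmap_cat mem_cat Xr.
set C := walk_set u t in tnull uvC.
have sC : C \subset edges e by apply/subsetP => X; rewrite inE; apply: path_steps.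
(* The first edge of the ear is held back: [H'] has nullity at least that of [C], and already joins
   [u] to [v] through [w], so adding [[set u; v]] gains one more. *)
pose H' := C :|: walk_set v r.
have uvH : [set u; v] \notin H'.
  rewrite in_setU (negbTE uvC) inE; apply/negP => /sr.
  by rewrite setD11.
have sH' : H' \subset edges e.
  rewrite subUset sC; apply/subsetP => X; rewrite inE => /sr.
  by rewrite in_setD1 => /andP[].
have sH : [set u; v] |: H' \subset edges e by rewrite subUset sub1set XE.
have uv : conn H' u v.
  apply: (@connect_trans _ _ w).
    apply: (conn_sub (subsetUl _ _)); apply: (@conn_steps _ _ _ t).
      by move=> X; rewrite inE.
    by rewrite in_cons wt orbT.
  rewrite conn_sym; apply: (conn_sub (subsetUr _ _)); apply: (@conn_steps _ _ _ r).
    by move=> X; rewrite inE.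
  by rewrite -lr mem_last.
have HE : [set u; v] |: H' = edges e.
  apply: nullity2_eq_edges sH _; rewrite grank_setU1 // cardsU1 uvH /= add1n.
  have := nullity_edges (subsetUl C (walk_set v r)) sH'; rewrite -/H'.
  have arith a b c d : a < b -> b + c <= d + a -> c + 2 <= d.+1 by clear; lia.
  exact: arith tnull.
exists s, w; split=> //.
- rewrite sE /= euv; move: eqP; rewrite qE cat_path => /andP[] //.
- rewrite cat_uniq t_uniq st; move: q_uniq; rewrite vqE cat_uniq rcons_uniq.
  by case/andP => /andP[_ ->].
- by move=> X; rewrite -HE sE /= in_cons !inE orbCA.
Qed.

Lemma dense_three_path_graph : exists L, three_path_graph e L.
Proof.
have [x [t0 [t0P t0l t0_uniq t0n t0null]]] := exists_cycle.
have [u [v [ut0 euv uvC]]] := edge_leaving_cycle t0P t0l t0_uniq t0n.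
have [t [tP tl tt0 tE]] := rotate_cycle t0P t0l ut0.
have ut : u \in t by rewrite (perm_mem tt0).
have t_uniq : uniq t by rewrite (perm_uniq tt0).
rewrite -tE in uvC t0null.
have [s [w [sP wt ts_uniq cover]]] := exists_ear tP tl t_uniq ut t0null euv uvC.
(* The vertices in [t ++ s] are distinct, so cycle and ear together take at most [|V| + 1 = |E|]
   steps: the count needed by [three_path_graph_walks]. *)
have := max_card (mem (t ++ s)); rewrite (card_uniqP ts_uniq) size_cat => sz.
have cE := card_edges e_sym Gconn Gbeta.
move: ts_uniq; rewrite cat_uniq => /and3P[_ st s_uniq].
have disj z : z \in t -> z \in rcons s w -> z = w.
  rewrite mem_rcons in_cons => zt /predU1P[//|zs].
  by case/hasP: st; exists z.
have us : u \in rcons s w -> u = w by apply: disj.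
have s'_uniq : uniq (rcons s w).
  rewrite rcons_uniq s_uniq andbT; apply/negP => ws.
  by case/hasP: st; exists w.
have [wu|nwu] := eqVneq w u.
  (* The ear returns to [u]: two closed walks at [u], and an empty path that identifies start with
     end. *)
  subst w; pose T (i : 'I_3) := nth [::] [:: [::]; t; rcons s u] i.
  exists (fun i => size (T i)).
  apply: (@three_path_graph_walks _ _ _ _ _ u u) => //.
  - by case=> [[|[|[|]]]] //= ?; split; rewrite //= ?last_rcons.
  - case=> [[|[|[|]]]] //= ? [[|[|[|]]]] //= ? z _; rewrite /T /= => h1 h2.
      exact: disj.
    exact: disj.
  - by move=> _; exists ord0.
  - move=> X /cover/orP[h|h]; first by exists (inord 1); rewrite /T inordK.
    by exists (inord 2); rewrite /T inordK.
  - rewrite !big_ord_recl big_ord0 /T /= size_rcons cE.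
    by rewrite add0n addn0 addnS ltnS.
(* Now [w] cuts the cycle into two arcs. The second runs from [w] back to [u] and is reversed, so
   that all three walks lead from [u] to [w]. *)
case/path.splitP: wt tP tl t_uniq ut sz disj cover {tE tt0 uvC t0null st} => a b.
rewrite cat_path last_rcons last_cat last_rcons => /andP[aP bP].
case: (lastP b) bP => [|b' z]; first by move=> _ /= wu; rewrite wu eqxx in nwu.
rewrite last_rcons => bP zu; subst z.
rewrite cat_uniq => /and3P[a_uniq ab b_uniq] _; rewrite size_cat !size_rcons => sz disj cover.
have ua : u \notin rcons a w.
  by apply: contra ab => ua; apply/hasP; exists u; rewrite // mem_rcons mem_head.
have wb : w \notin rcons b' u.
  by apply: contra ab => wb; apply/hasP; exists w; rewrite // mem_rcons mem_head.
have b'E : rev (w :: b') = rev (belast w (rcons b' u)) by rewrite belast_rcons.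
have b'P : path e u (rev (w :: b')).
  rewrite b'E -{1}(last_rcons w b' u) rev_path.
  by apply: sub_path bP => i j /=; rewrite e_sym.
have b'steps : steps u (rev (w :: b')) =i steps w (rcons b' u).
  by move=> X; rewrite b'E -{1}(last_rcons w b' u) steps_rev.
move: b_uniq wb; rewrite rcons_uniq mem_rcons in_cons negb_or => /andP[ub b_uniq] /andP[_ wb].
have inb y : y \in rev (w :: b') -> y = w \/ y \in b'.
  by rewrite mem_rev in_cons => /predU1P.
have ab' y : y \in rcons a w -> y \in b' -> y = w.
  by move=> ya yb; case/hasP: ab; exists y; rewrite // mem_rcons in_cons yb orbT.
pose T (i : 'I_3) := nth [::] [:: rcons a w; rev (w :: b'); rcons s w] i.
exists (fun i => size (T i)).
have disjT (i j : 'I_3) y : i < j -> y \in T i -> y \in T j -> y = w.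
  case: i j => [[|[|[|]]]] //= ? [[|[|[|]]]] //= ? _; rewrite /T /= => h1 h2.
  - by case: (inb _ h2) => // /(ab' _ h1).
  - by apply: disj; rewrite // mem_cat h1.
  - case: (inb _ h1) => // yb; apply: disj => //.
    by rewrite mem_cat !mem_rcons !in_cons yb !orbT.
apply: (@three_path_graph_walks _ _ _ _ _ u w) => //.
- case=> [[|[|[|]]]] //= ?; rewrite /T /=; split=> //.
  + by rewrite last_rcons.
  + by move=> h; rewrite h in ua.
  + by rewrite rev_cons last_rcons.
  + by rewrite rev_uniq /= wb.
  + by case/inb => // h; rewrite h in ub.
  + by rewrite last_rcons.
- move=> i j y nij yi yj; have [ij|ji] := ltnP i j; first exact: disjT ij yi yj.
  apply: disjT yj yi; rewrite ltn_neqAle ji andbT eq_sym.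
  exact: nij.
- by move=> uw; rewrite uw eqxx in nwu.
- move=> X /cover; rewrite pairmap_cat mem_cat last_rcons => /orP[/orP[]|] h.
  + by exists ord0.
  + by exists (inord 1); rewrite /T inordK // b'steps.
  + by exists (inord 2); rewrite /T inordK.
- rewrite !big_ord_recl big_ord0 /T /= size_rev /= !size_rcons cE.
  by rewrite addn0 addnA addnS ltnS.
Qed.

End Ears.

Theorem theorem3p10 (V : finType) (e : rel V)
  (e_sym : symmetric e) (e_irr : irreflexive e)
  (Gconn : connected_graph e) (Gbeta : beta e = Posz 2) :
  uniformly_dense e <->
  exists L1 L2 L3 : nat,
    [/\ (L3 - L2 <= L1)%N, (L1 <= L2)%N, (L2 <= L3)%N
      & three_path_graph e (lens3 L1 L2 L3)].
Proof.
split=> [dense|[L1 [L2 [L3 [L321 L12 L23 [f [f_id f_onto f_edge f_edges f_inj]]]]]]].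
  have [L LG] := dense_three_path_graph e_sym e_irr Gconn Gbeta dense.
  have [L1 [L2 [L3 [s [L12 L23 s_inj Ls]]]]] := sort3 L.
  exists L1, L2, L3.
  have G := three_path_graph_reindex s_inj Ls LG; split=> //.
  case: G => f [f_id f_onto f_edge f_edges f_inj].
  (* Only the longest path matters: [2 * L3 <= L1 + L2 + L3] is the bound [L3 - L2 <= L1]. *)
  have [/(_ dense)/(_ ord_max) + _] :=
    uniformly_dense_three_paths e_sym e_irr Gconn Gbeta f_id f_onto f_edge f_edges f_inj.
  rewrite (card_edges_paths e_sym f_edge f_edges f_inj).
  by rewrite !big_ord_recl big_ord0 /lens3 /=; lia.
(* Conversely, the order of the lengths settles the two shorter paths, and [L3 - L2 <= L1] the
   longest. *)
have [_] := uniformly_dense_three_paths e_sym e_irr Gconn Gbeta f_id f_onto f_edge f_edges f_inj.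
apply; rewrite (card_edges_paths e_sym f_edge f_edges f_inj).
rewrite !big_ord_recl big_ord0 /lens3 /=.
by case=> [[|[|[|]]]] //= _; lia.
Qed.
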